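(* Let $(\mathbf E,\mathbf d)$ be a conditionally complete conditional metric space, and suppose that $\mathbf E=\sqcup_{\mathbf n\in\mathbf N}\mathbf E_{\mathbf n}$ for a conditional family $\{\mathbf E_{\mathbf n}\}_{\mathbf n\in\mathbf N}$ of conditionally closed subsets of $\mathbf E$. Then there exist a conditional ball $\mathbf B_{\mathbf r}(\mathbf x)$ on $1$ (with $\mathbf x\in\mathbf E$, $\mathbf r\in\mathbf R^{++}$) and $\mathbf n\in\mathbf N$ such that $\mathbf B_{\mathbf r}(\mathbf x)\sqsubset\mathbf E_{\mathbf n}$.
   Context: Throughout, $\mathcal A$ is a fixed complete Boolean algebra with operations $\vee,\wedge,{}^c$ and bounds $0,1$; $\mathcal A_a=\{b\in\mathcal A: b\le a\}$; $p(a)$ is the set of families $\{a_i\}_{i\in I}$ of pairwise disjoint elements of $\mathcal A$ (some possibly $0$) with supremum $a$. Conditional sets. A conditional set $\mathbf E$ of a nonempty set $E$ is a collection of objects $x|a$ ($x\in E$, $a\in\mathcal A$) such that: $x|a=y|b$ implies $a=b$; if $a\le b$ and $x|b=y|b$ then $x|a=y|a$; for all $\{a_i\}\in p(1)$ and $\{x_i\}\subset E$ there is a unique $x\in E$, denoted $\sum x_i|a_i$, with $x|a_i=x_i|a_i$ for all $i$. The conditional elements of $\mathbf E$ are the objects $\mathbf x=x|1$, $x\in E$; write $\mathbf x\in\mathbf E$. A nonempty $F\subset E$ is stable if it contains all $\sum x_i|a_i$ with $\{a_i\}\in p(1)$, $\{x_i\}\subset F$; the stable hull of a nonempty set is the smallest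 stable set containing it. For $F$ stable and $a\in\mathcal A$, $\mathbf F|a=\{x|b: x\in F,\ b\le a\}$ is called a conditional subset of $\mathbf E$ on $a$ (and $\mathbf F=\mathbf F|1$); its conditional elements are the $x|a$ with $x\in F$. We write $\mathbf F\sqsubset\mathbf E$ for ''$\mathbf F$ is a conditional subset of $\mathbf E$ on some $a$''; between conditional subsets, $\sqsubset$ is inclusion of collections. $\mathbf E|0$ is the null conditional subset. $[\mathbf x\in\mathbf E:\phi(\mathbf x)]$ is the conditional subset on $1$ generated by the stable hull of the (nonempty) set $\{x:\phi(\mathbf x)\}$. $\sqcap$ is intersection, $\sqcup$ is the smallest conditional subset containing the given ones, and $\mathbf F^{\sqsubset}$ is the largest conditional subset $\mathbf G$ with $\mathbf F\sqcap\mathbf G=\mathbf E|0$. Functions and families. A function $f:E\to F$ is stable if $f(\sum x_i|a_i)=\sum f(x_i)|a_i$; it then defines a conditional function $\mathbf f:\mathbf E\to\mathbf F$, $\mathbf f(\mathbf x)=f(x)|1$. $\mathbf E\Join\mathbf F$ is the conditional set of $E\times F$ with $(x,y)|a=(x|a,y|a)$. A conditional sequence $\{\mathbf x_{\mathbf n}\}_{\mathbf n\in\mathbf N}$ in $\mathbf E$ is a conditional function $\mathbf n\mapsto\mathbf x_{\mathbf n}$ from $\mathbf N$ to $\mathbf E$. A conditional family of conditional subsets $\{\mathbf E_{\mathbf n}\}_{\mathbf n\in\mathbf N}$ consists of conditional subsets on $1$ with $\mathbf E_{\mathbf n}|a_j=\mathbf E_{\mathbf n_j}|a_j$ for all $j$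 whenever $n=\sum n_j|a_j$. Numbers. $\mathbf N$ (resp. $\mathbf Q$) is the conditional set whose generating set $N$ (resp. $Q$) consists of formal sums $\sum n_i|a_i$ with $\{a_i\}\in p(1)$ and $n_i\in\mathbb N=\{1,2,\dots\}$ (resp. $n_i\in\mathbb Q$), where $(\sum n_i|a_i)|a=(\sum m_j|b_j)|a$ iff $n_i=m_j$ whenever $a_i\wedge b_j\wedge a\ne0$; operations and order are componentwise ($\sum n_i|a_i\le\sum m_j|b_j$ iff $n_i\le m_j$ whenever $a_i\wedge b_j\ne0$; similarly $<$). $\mathbf R$ denotes the conditional real numbers: the conditionally totally ordered, conditionally Dedekind complete field containing $\mathbf Q$ (extending its operations and order). That is, $\mathbf R$ is a conditional set of a set $R$ with stable commutative ring operations such that every $r$ with $r|a\neq 0|a$ for all $a\ne0$ is invertible, and with a stable partial order compatible with the ring operations such that for all $r,s$ there is $a$ with $r|a\le s|a$ and $s|a^c\le r|a^c$ (where $r|a\le s|a$ means $r|a+s|a^c\le s$), and every conditional subset on $1$ with an upper bound has a supremum. It is unique up to isomorphism; for the measure algebra of a $\sigma$-finite measure space $R=L^0$. $\mathbf r<\mathbf s$ means $\mathbf r\le\mathbf s$ and $r|a\ne s|a$ for all $a\neq0$. $\mathbf R^+=[\mathbf r\ge\mathbf 0]$, $\mathbf R^{++}=[\mathbf r>\mathbf 0]$. Metric spaces. A conditional metric on $\mathbf E$ is a conditional function $\mathbf d:\mathbf E\Join\mathbf E\to\mathbf R^+$ that is symmetric, satisfies the triangle inequality, and satisfies $\mathbf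 d(\mathbf x,\mathbf y)=\mathbf 0$ iff $\mathbf x=\mathbf y$. Put $\mathbf B_{\mathbf r}(\mathbf x)=[\mathbf y\in\mathbf E:\mathbf d(\mathbf x,\mathbf y)\le\mathbf r]$. A conditional subset $\mathbf O$ on $a$ is conditionally open iff for every $x\in E$ with $x|a\in\mathbf O$ there is $\mathbf r\in\mathbf R^{++}$ with $\mathbf B_{\mathbf r}(\mathbf x)|a\sqsubset\mathbf O$; $\mathbf F$ is conditionally closed iff $\mathbf F^{\sqsubset}$ is conditionally open. A conditional sequence $\{\mathbf x_{\mathbf n}\}$ is conditionally Cauchy if for each $\mathbf r\in\mathbf R^{++}$ there is $\mathbf n\in\mathbf N$ with $\mathbf d(\mathbf x_{\mathbf p},\mathbf x_{\mathbf q})\le\mathbf r$ for all $\mathbf p,\mathbf q>\mathbf n$; it conditionally converges to $\mathbf x$ if for each $\mathbf r\in\mathbf R^{++}$ there is $\mathbf m$ with $\mathbf d(\mathbf x_{\mathbf n},\mathbf x)\le\mathbf r$ for all $\mathbf n\ge\mathbf m$. $(\mathbf E,\mathbf d)$ is conditionally complete if every conditionally Cauchy sequence conditionally converges. *)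

(* Defs.v *)
From HB Require Import structures.
From mathcomp Require Import all_boot all_order all_algebra.
From mathcomp Require Import boolp classical_sets cardinality.

Set Implicit Arguments.
Unset Strict Implicit.
Unset Printing Implicit Defensive.

Import Order.Theory GRing.Theory Num.Theory.
Local Open Scope classical_set_scope.

HB.mixin Record isCompleteBoole (d : Order.disp_t) T
    of Order.CTBDistrLattice d T := {
  csup : set T -> T;
  csup_ub : forall (S : set T) (x : T), S x -> (x <= csup S)%O;
  csup_le : forall (S : set T) (y : T),
    (forall x, S x -> (x <= y)%O) -> (csup S <= y)%O
}.

#[short(type="completeBooleType")]
HB.structure Definition CompleteBoole (d : Order.disp_t) :=
  { T of Order.CTBDistrLattice d T & isCompleteBoole d T }.

(* Index types are arbitrary, and members of the family may be [\bot]. *)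
Definition cpartition d (A : completeBooleType d) (a : A) (I : Type)
    (u : I -> A) : Prop :=
  (forall i j : I, i <> j -> (u i `&` u j)%O = \bot%O) /\ csup (range u) = a.

(* The objects x|a are the values [restr x a]; [cobj] is an ambient type for
   them, in which elements that are not of this form play no role. *)
HB.mixin Record isCondSet (d : Order.disp_t) (A : completeBooleType d)
    (E : Type) := {
  cobj : Type;
  restr : E -> A -> cobj;
  cinhabited : inhabited E;
  restr_inj : forall (x y : E) (a b : A), restr x a = restr y b -> a = b;
  restr_le : forall (x y : E) (a b : A),
    (a <= b)%O -> restr x b = restr y b -> restr x a = restr y a;
  concat_uniq : forall (I : Type) (u : I -> A) (x_ : I -> E),
    cpartition \top%O u ->
    exists! x : E, forall i, restr x (u i) = restr (x_ i) (u i)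
}.

#[short(type="condSetType")]
HB.structure Definition CondSet (d : Order.disp_t) (A : completeBooleType d) :=
  { E of isCondSet d A E }.

Arguments cobj {d A} s.
Arguments restr_inj {d A s} [x y a b].
Arguments restr_le {d A s} [x y a b].
Arguments concat_uniq {d A s} [I u] x_.

Notation "x \at a" := (restr x a) (at level 38, no associativity).

Section ConditionalSubsets.
Context {d : Order.disp_t} {A : completeBooleType d}.

(* [is_concat u x_ x] says that x = \sum_i x_ i | u i. *)
Definition is_concat (E : condSetType A) (I : Type) (u : I -> A)
    (x_ : I -> E) (x : E) : Prop :=
  forall i, x \at u i = x_ i \at u i.

Definition stable_set (E : condSetType A) (F : set E) : Prop :=
  F !=set0 /\
  forall (I : Type) (u : I -> A) (x_ : I -> E) (x : E),
    cpartition \top%O u -> (forall i, F (x_ i)) -> is_concat u x_ x -> F x.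

Definition stable_hull (E : condSetType A) (S : set E) : set E :=
  [set x | forall F : set E, stable_set F -> S `<=` F -> F x].

(* The collection F|a; the conditional subset on 1 generated by F is
   [csubset F \top]. *)
Definition csubset (E : condSetType A) (F : set E) (a : A) : set (cobj E) :=
  [set o | exists x b, [/\ F x, (b <= a)%O & o = x \at b]].

Definition is_csubset_on (E : condSetType A) (a : A) (G : set (cobj E)) : Prop :=
  exists2 F : set E, stable_set F & G = csubset F a.

Definition is_csubset (E : condSetType A) (G : set (cobj E)) : Prop :=
  exists a : A, is_csubset_on a G.

Definition cnull (E : condSetType A) : set (cobj E) := csubset [set: E] \bot%O.
Arguments cnull E : clear implicits.

Definition cfull (E : condSetType A) : set (cobj E) := csubset [set: E] \top%O.
Arguments cfull E : clear implicits.

(* H is the union (in the conditional sense) of the collections in GG. *)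
Definition is_cunion (E : condSetType A) (GG : set (set (cobj E)))
    (H : set (cobj E)) : Prop :=
  [/\ is_csubset H, (forall G, GG G -> G `<=` H) &
      forall H', is_csubset H' -> (forall G, GG G -> G `<=` H') -> H `<=` H'].

Definition is_ccompl (E : condSetType A) (F G : set (cobj E)) : Prop :=
  [/\ is_csubset G, F `&` G = cnull E &
      forall G', is_csubset G' -> F `&` G' = cnull E -> G' `<=` G].

(* Since x |-> x|1 is injective, conditional functions between conditional
   sets are the same as stable functions between their generating sets. *)
Definition stable_fun (E F : condSetType A) (f : E -> F) : Prop :=
  forall (I : Type) (u : I -> A) (x_ : I -> E) (x : E),
    cpartition \top%O u -> is_concat u x_ x ->
    is_concat u (fun i => f (x_ i)) (f x).

End ConditionalSubsets.

Arguments cnull {d A} E.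
Arguments cfull {d A} E.

Section Product.
Context {d : Order.disp_t} {A : completeBooleType d} (E F : condSetType A).

Let prestr (p : E * F) (a : A) : cobj E * cobj F := (p.1 \at a, p.2 \at a).

Let pinhabited : inhabited (E * F).
Proof.
by case: (@cinhabited _ _ E) => x; case: (@cinhabited _ _ F) => y;
  exists; exact: (x, y).
Qed.

Let prestr_inj p q a b : prestr p a = prestr q b -> a = b.
Proof. by case=> /restr_inj. Qed.

Let prestr_le p q a b :
  (a <= b)%O -> prestr p b = prestr q b -> prestr p a = prestr q a.
Proof.
move=> ab [pq1 pq2]; rewrite /prestr.
by rewrite (restr_le ab pq1) (restr_le ab pq2).
Qed.

Let pconcat (I : Type) (u : I -> A) (p_ : I -> E * F) :
  cpartition \top%O u ->
  exists! p, forall i, prestr p (u i) = prestr (p_ i) (u i).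
Proof.
move=> pu.
have [x [xP xU]] := concat_uniq (fun i => (p_ i).1) pu.
have [y [yP yU]] := concat_uniq (fun i => (p_ i).2) pu.
exists (x, y); split=> [i|[x' y'] H]; first by rewrite /prestr /= xP yP.
by congr (_, _); [apply: xU|apply: yU] => i; case: (H i).
Qed.

HB.instance Definition _ := isCondSet.Build d A (E * F)%type
  pinhabited prestr_inj prestr_le pconcat.

End Product.

Section Sup.
Context {d : Order.disp_t} {A : completeBooleType d}.
Implicit Types (a b c x y : A) (S : set A).

Lemma csup_meetr S y z :
  (forall x, S x -> (x `&` y <= z)%O) -> (csup S `&` y <= z)%O.
Proof.
move=> H; have : (csup S <= z `|` ~` y)%O.
  apply: csup_le => x Sx.
  have -> : x = ((x `&` y) `|` (x `&` ~` y))%O by rewrite -meetUr joinxC meetx1.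
  by apply: leU2; [exact: H|exact: leIr].
move=> /(leI2 (lexx y)); rewrite meetC => /le_trans; apply.
by rewrite meetUr meetxC joinx0 leIr.
Qed.

Lemma csup_meet_eq0 S y :
  (forall x, S x -> (x `&` y)%O = \bot%O) -> (csup S `&` y)%O = \bot%O.
Proof.
by move=> H; apply/eqP; rewrite -lex0; apply: csup_meetr => x /H ->.
Qed.

Lemma cpartition_le (I : Type) (u : I -> A) (b z : A) :
  cpartition \top%O u -> (forall i, (u i `&` b <= z)%O) -> (b <= z)%O.
Proof.
move=> [_ uT] H; rewrite -[b]meet1x -uT.
by apply: csup_meetr => _ [i _ <-].
Qed.

Lemma cpartition_meet (I J : Type) (u : I -> A) (v : J -> A) :
  cpartition \top%O u -> cpartition \top%O v ->
  cpartition \top%O (fun p : I * J => (u p.1 `&` v p.2)%O).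
Proof.
move=> pu pv; split=> [[i j] [i' j'] /= ne|].
  have [ei|ni] := pselect (i = i'); last first.
    by rewrite meetACA (pu.1 _ _ ni) meet0x.
  rewrite meetACA [X in (_ `&` X)%O](pv.1 j j') ?meetx0 // => ej.
  by apply: ne; rewrite ei ej.
apply/le_anti; rewrite lex1 /=.
apply: (cpartition_le pu) => i; rewrite meetx1; apply: (cpartition_le pv) => j.
by apply: csup_ub; exists (i, j) => //=; rewrite meetC.
Qed.

Lemma cpartition_unit : cpartition \top%O (fun _ : unit => \top%O : A).
Proof.
split=> [[] []//|]; apply/le_anti; rewrite lex1 /=.
by apply: csup_ub; exists tt.
Qed.

End Sup.

(* A formal sum \sum_i x_i | a_i of elements of V is determined, up to the
   identification of formal sums, by the elements sup {a_i : x_i = v}, v : V,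
   which form a partition of 1. This normal form stands for the class of the
   formal sum; [fsum] below maps a formal sum to its class, and lemmas
   [fsum_restrE], [fsum_surj], [frelE], [fopE] show that equality on a, order
   and operations are the prescribed ones. *)
Record formal_sum d (A : completeBooleType d) (V : Type) := FormalSum {
  fs_at :> V -> A;
  fs_part : cpartition \top%O fs_at
}.

Section FormalSum.
Context {d : Order.disp_t} {A : completeBooleType d}.

Lemma formal_sumP (V : Type) (x y : formal_sum A V) :
  (forall v, x v = y v) -> x = y.
Proof.
case: x y => [x px] [y py] /= xy; have {}xy : x = y by exact: funext.
by subst y; congr FormalSum; exact: Prop_irrelevance.
Qed.

Section Fsum.
Context (V I : Type) (u : I -> A) (x : I -> V).

Definition fsum_at (v : V) : A := csup (u @` [set i | x i = v]).

Lemma fsum_part : cpartition \top%O u -> cpartition \top%O fsum_at.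
Proof.
move=> pu; split=> [v w vw|].
  apply: csup_meet_eq0 => _ [i /= xi <-]; rewrite meetC.
  apply: csup_meet_eq0 => _ [j /= xj <-]; apply: pu.1 => ji.
  by apply: vw; rewrite -xi -xj ji.
apply/le_anti; rewrite lex1 /=; apply: (cpartition_le pu) => i; rewrite meetx1.
apply: (@le_trans _ _ (fsum_at (x i))); first by apply: csup_ub; exists i.
by apply: csup_ub; exists (x i).
Qed.

Definition fsum (pu : cpartition \top%O u) : formal_sum A V :=
  FormalSum (fsum_part pu).

Lemma fsum_at_meet (pu : cpartition \top%O u) v i :
  x i <> v -> (u i `&` fsum_at v)%O = \bot%O.
Proof.
move=> xiv; rewrite meetC; apply: csup_meet_eq0 => _ [j /= xj <-].
by apply: pu.1 => ji; apply: xiv; rewrite -ji.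
Qed.

End Fsum.

Definition fs_const (V : Type) (v : V) : formal_sum A V :=
  fsum (fun _ : unit => v) cpartition_unit.

Section Restriction.
Context (V : pointedType).
Implicit Types x y : formal_sum A V.

Let finhabited : inhabited (formal_sum A V).
Proof. by exists; exact: fs_const point. Qed.

Let frestr x (a : A) : A * (V -> A) := (a, fun v => (x v `&` a)%O).

Let frestr_inj x y a b : frestr x a = frestr y b -> a = b.
Proof. by case. Qed.

Let frestr_le x y a b :
  (a <= b)%O -> frestr x b = frestr y b -> frestr x a = frestr y a.
Proof.
move=> /meet_idPr ab [/funeqP H]; congr pair; apply: funext => v.
by rewrite -ab !meetA H.
Qed.

Let fconcat (I : Type) (u : I -> A) (x_ : I -> formal_sum A V) :
  cpartition \top%O u ->
  exists! x, forall i, frestr x (u i) = frestr (x_ i) (u i).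
Proof.
move=> pu.
pose f v := csup (range (fun i => (x_ i v `&` u i)%O)).
have fE v i : (f v `&` u i)%O = (x_ i v `&` u i)%O.
  apply/le_anti/andP; split; last first.
    by rewrite lexI leIr andbT; apply: csup_ub; exists i.
  apply: csup_meetr => _ [j _ <-].
  have [->|ji] := pselect (j = i); first by rewrite -meetA meetxx.
  by rewrite -meetA (pu.1 _ _ ji) meetx0 le0x.
have pf : cpartition \top%O f.
  split=> [v w vw|].
    apply: csup_meet_eq0 => _ [i _ <-].
    by rewrite -meetA [(u i `&` _)%O]meetC fE meetA ((fs_part (x_ i)).1 _ _ vw) meet0x.
  apply/le_anti; rewrite lex1 /=; apply: (cpartition_le pu) => i; rewrite meetx1.
  apply: (cpartition_le (fs_part (x_ i))) => v; rewrite -fE.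
  by apply: leIxl; apply: csup_ub; exists v.
exists (FormalSum pf); split=> [i|y yP].
  by congr pair; apply: funext => v; exact: fE.
apply: formal_sumP => v /=.
have yE i : (y v `&` u i)%O = (f v `&` u i)%O.
  by rewrite fE; case: (yP i) => /funeqP /(_ v) ->.
apply/le_anti/andP; split; apply: (cpartition_le pu) => i; rewrite meetC.
  by rewrite -yE leIl.
by rewrite yE leIl.
Qed.

HB.instance Definition _ := isCondSet.Build d A (formal_sum A V)
  finhabited frestr_inj frestr_le fconcat.

End Restriction.

Lemma fsum_surj (V : Type) (x : formal_sum A V) :
  exists (I : Type) (u : I -> A) (v : I -> V) (pu : cpartition \top%O u),
    x = fsum v pu.
Proof.
exists V, x, id, (fs_part x); apply: formal_sumP => v /=.
apply/le_anti/andP; split; first by apply: csup_ub; exists v.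
by apply: csup_le => _ [w /= -> <-].
Qed.

Lemma fsum_meet_neq0 (V W I J : Type) (u : I -> A) (v : J -> A)
    (x : I -> V) (y : J -> W)
    (pu : cpartition \top%O u) (pv : cpartition \top%O v) (a : A) p q :
  (fsum x pu p `&` fsum y pv q `&` a)%O <> \bot%O <->
  exists i j, [/\ x i = p, y j = q & (u i `&` v j `&` a)%O <> \bot%O].
Proof.
split=> [H|[i [j [<- <-]]] H].
  apply: contrapT => nex; apply: H; rewrite -meetA.
  apply: csup_meet_eq0 => _ [i /= xi <-]; rewrite meetCA.
  apply: csup_meet_eq0 => _ [j /= yj <-]; rewrite meetCA meetA.
  by apply: contrapT => H; apply: nex; exists i, j.
move=> H0; apply: H; apply/eqP; rewrite -lex0 -H0.
by apply: leI2 => //; apply: leI2; apply: csup_ub; [exists i|exists j].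
Qed.

Lemma fsum_restrE (V : pointedType) (I J : Type) (u : I -> A) (v : J -> A)
    (x : I -> V) (y : J -> V)
    (pu : cpartition \top%O u) (pv : cpartition \top%O v) (a b : A) :
  fsum x pu \at a = fsum y pv \at b <->
  a = b /\ forall i j, (u i `&` v j `&` a)%O <> \bot%O -> x i = y j.
Proof.
have key (z t : formal_sum A V) :
    (forall p q, (z p `&` t q `&` a)%O <> \bot%O -> p = q) ->
    forall p, (z p `&` a <= t p `&` a)%O.
  move=> H p; rewrite lexI leIr andbT.
  apply: (cpartition_le (fs_part t)) => q; rewrite meetCA meetA.
  have [->|pq] := pselect (p = q); first by rewrite -meetA; apply: leIxr; apply: leIl.
  have [->|/H//] := pselect ((z p `&` t q `&` a)%O = \bot%O); exact: le0x.
split=> [H|[<- H]].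
  have ab : a = b by apply: restr_inj H.
  split=> // i j; rewrite -{}ab {b} in H => uv0.
  have {uv0} : (fsum x pu (x i) `&` fsum y pv (y j) `&` a)%O <> \bot%O.
    by apply/fsum_meet_neq0; exists i, j.
  have [//|xy] := pselect (x i = y j); case.
  case: H => /funeqP /(_ (x i)) /= H.
  by rewrite meetAC H meetAC ((fs_part (fsum y pv)).1 _ _ xy) meet0x.
have {}H p q : (fsum x pu p `&` fsum y pv q `&` a)%O <> \bot%O -> p = q.
  by case/fsum_meet_neq0 => i [j [<- <- /H]].
congr pair; apply: funext => p; apply/le_anti/andP; split.
  exact: key.
by apply: key => q r; rewrite [(_ `&` fsum x _ _)%O]meetC => /H.
Qed.

Section Rel.
Context (V W : Type) (r : V -> W -> Prop).

Definition frel (x : formal_sum A V) (y : formal_sum A W) : Prop :=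
  forall v w, (x v `&` y w)%O <> \bot%O -> r v w.

Lemma frelE (I J : Type) (u : I -> A) (v : J -> A) (x : I -> V) (y : J -> W)
    (pu : cpartition \top%O u) (pv : cpartition \top%O v) :
  frel (fsum x pu) (fsum y pv) <->
  forall i j, (u i `&` v j)%O <> \bot%O -> r (x i) (y j).
Proof.
have key := fsum_meet_neq0 x y pu pv \top%O.
split=> [H i j ij|H p q]; last first.
  rewrite -[X in X <> _]meetx1 => /key[i [j [<- <-]]].
  by rewrite meetx1 => /H.
by apply: H; rewrite -[X in X <> _]meetx1; apply/key; exists i, j; rewrite meetx1.
Qed.

End Rel.

Section Op.
Context (V W X : Type) (op : V -> W -> X).

Definition fop (x : formal_sum A V) (y : formal_sum A W) : formal_sum A X :=
  fsum (fun p : V * W => op p.1 p.2) (cpartition_meet (fs_part x) (fs_part y)).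

Lemma fopE (I J : Type) (u : I -> A) (v : J -> A) (x : I -> V) (y : J -> W)
    (pu : cpartition \top%O u) (pv : cpartition \top%O v) :
  fop (fsum x pu) (fsum y pv) =
  fsum (fun p : I * J => op (x p.1) (y p.2)) (cpartition_meet pu pv).
Proof.
apply: formal_sumP => z /=; apply/le_anti/andP; split.
  apply: csup_le => _ [[p q] /= pqz <-].
  apply: csup_meetr => _ [i /= xi <-]; rewrite meetC.
  apply: csup_meetr => _ [j /= yj <-]; rewrite meetC.
  by apply: csup_ub; exists (i, j) => //=; rewrite xi yj.
apply: csup_le => _ [[i j] /= ijz <-].
apply: (@le_trans _ _ (fsum_at u x (x i) `&` fsum_at v y (y j))%O).
  by apply: leI2; apply: csup_ub; [exists i|exists j].
by apply: csup_ub; exists (x i, y j).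
Qed.

End Op.
End FormalSum.

Section Numbers.
Context {d : Order.disp_t} (A : completeBooleType d).

Definition posnat := {n : nat | (0 < n)%N}.
HB.instance Definition _ := Choice.on posnat.
HB.instance Definition _ :=
  isPointed.Build posnat (exist _ 1%N (ltn0Sn 0)).

Definition condNat : condSetType A := formal_sum A posnat.
Definition condRat : condSetType A := formal_sum A rat.

Definition cnat_le (m n : condNat) : Prop :=
  frel (fun i j : posnat => (val i <= val j)%N) m n.
Definition cnat_lt (m n : condNat) : Prop :=
  frel (fun i j : posnat => (val i < val j)%N) m n.

Definition crat_le (p q : condRat) : Prop :=
  frel (fun x y : rat => (x <= y)%R) p q.
Definition crat_add (p q : condRat) : condRat := fop +%R p q.
Definition crat_mul (p q : condRat) : condRat := fop *%R p q.
Definition crat_one : condRat := fs_const 1%R.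

End Numbers.

(* The relation r|a <= s|a, i.e. r|a + s|a^c <= s. *)
Definition le_at d (A : completeBooleType d) (R : condSetType A)
    (le : R -> R -> Prop) (r s : R) (a : A) : Prop :=
  exists t : R, [/\ t \at a = r \at a, t \at (~` a)%O = s \at (~` a)%O & le t s].

Local Open Scope ring_scope.

(* [crat] embeds the conditional rationals; it also excludes rings that are
   degenerate on some a <> \bot, e.g. the zero ring. *)
HB.mixin Record isCondReal (d : Order.disp_t) (A : completeBooleType d) R
    of CondSet d A R & GRing.ComPzRing R := {
  stable_add : stable_fun (fun p : R * R => p.1 + p.2);
  stable_opp : stable_fun (fun r : R => - r);
  stable_mul : stable_fun (fun p : R * R => p.1 * p.2);
  cinvertible : forall r : R,
    (forall a : A, a <> \bot%O -> r \at a <> (0 : R) \at a) -> exists s : R, r * s = 1;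
  cle : R -> R -> Prop;
  cle_refl : forall r : R, cle r r;
  cle_anti : forall r s : R, cle r s -> cle s r -> r = s;
  cle_trans : forall r s t : R, cle r s -> cle s t -> cle r t;
  stable_cle : stable_set [set p : R * R | cle p.1 p.2];
  cle_add : forall r s t : R, cle r s -> cle (r + t) (s + t);
  cle_mul : forall r s : R, cle 0 r -> cle 0 s -> cle 0 (r * s);
  cle_total : forall r s : R, exists a : A,
    le_at cle r s a /\ le_at cle s r (~` a)%O;
  csupremum : forall F : set R, stable_set F ->
    (exists u, forall r, F r -> cle r u) ->
    exists s, (forall r, F r -> cle r s) /\
      (forall u, (forall r, F r -> cle r u) -> cle s u);
  crat : condRat A -> R;
  stable_crat : stable_fun crat;
  crat_addE : forall p q, crat (crat_add p q) = crat p + crat q;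
  crat_mulE : forall p q, crat (crat_mul p q) = crat p * crat q;
  crat_oneE : crat (crat_one A) = 1;
  crat_leE : forall p q, cle (crat p) (crat q) <-> crat_le p q
}.

#[short(type="condRealType")]
HB.structure Definition CondReal (d : Order.disp_t) (A : completeBooleType d) :=
  { R of CondSet d A R & GRing.ComPzRing R & isCondReal d A R }.

Notation "r <=c s" := (cle r s) (at level 70, no associativity) : ring_scope.

Section Metric.
Context {d : Order.disp_t} {A : completeBooleType d} {R : condRealType A}.

Definition clt (r s : R) : Prop :=
  r <=c s /\ forall a : A, a <> \bot%O -> r \at a <> s \at a.

(* Generating sets of R^+ and R^++. *)
Definition Rplus : set R := stable_hull [set r : R | 0 <=c r].
Definition Rpplus : set R := stable_hull [set r : R | clt 0 r].

Context {E : condSetType A}.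
Implicit Types dist : E * E -> R.

Definition cmetric dist : Prop :=
  [/\ stable_fun dist,
      forall p, Rplus (dist p),
      forall x y, dist (x, y) = dist (y, x),
      forall x y z, dist (x, z) <=c dist (x, y) + dist (y, z) &
      forall x y, dist (x, y) = 0 <-> x = y].

(* Generating set of the ball B_r(x); thus B_r(x)|a is
   [csubset (cball dist x r) a]. *)
Definition cball dist (x : E) (r : R) : set E :=
  stable_hull [set y | dist (x, y) <=c r].

Definition copen dist (O : set (cobj E)) : Prop :=
  exists2 a : A, is_csubset_on a O &
    forall x : E, O (x \at a) ->
      exists2 r, Rpplus r & csubset (cball dist x r) a `<=` O.

Definition cclosed dist (F : set (cobj E)) : Prop :=
  is_csubset F /\ exists2 G, is_ccompl F G & copen dist G.

Definition ccauchy dist (x_ : condNat A -> E) : Prop :=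
  forall r, Rpplus r -> exists n, forall p q,
    cnat_lt n p -> cnat_lt n q -> dist (x_ p, x_ q) <=c r.

Definition cconverges dist (x_ : condNat A -> E) (x : E) : Prop :=
  forall r, Rpplus r -> exists m, forall n, cnat_le m n -> dist (x_ n, x) <=c r.

Definition ccomplete dist : Prop :=
  forall x_ : condNat A -> E, stable_fun x_ -> ccauchy dist x_ ->
    exists x, cconverges dist x_ x.

End Metric.

(* A conditional family of conditional subsets on 1, each given by its
   generating stable set. *)
Definition cfamily d (A : completeBooleType d) (E : condSetType A)
    (F_ : condNat A -> set E) : Prop :=
  (forall n, stable_set (F_ n)) /\
  forall (I : Type) (u : I -> A) (n_ : I -> condNat A) (n : condNat A),
    cpartition \top%O u -> is_concat u n_ n ->
    forall i, csubset (F_ n) (u i) = csubset (F_ (n_ i)) (u i).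

(* Main.v *)
Require Import Defs.
From HB Require Import structures.
From mathcomp Require Import all_boot all_order all_algebra.
From mathcomp Require Import boolp classical_sets.

(** The proof is the classical Baire argument, read in the Boolean-valued
universe over [A]. A property of conditional elements does not hold or fail
outright: it holds on some conditions [a : A]. For the properties that occur
here, the conditions on which they hold are exactly those below a single
element of [A], their truth value; this is the notion [local]. What makes the
classical argument go through is the maximum principle [mixing]: if below every
nonzero condition some witness works on a smaller nonzero condition, then the
local witnesses can be concatenated into one witness. It rests on
[exhaustion], the only use of Zorn's lemma.

Ask whether, below every nonzero condition, some ball is contained in some
[E_ n]. If so, mixing the centres, radii and indices gives the ball on [\top]
([ball_or_thin]). Otherwise there is a condition [b <> \bot] below which no
ball is contained in any [E_ n], on any nonzero part of [b]. Closedness then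
yields, inside any ball and for any [n], a smaller ball all of whose points
avoid [E_ n] on every nonzero part of [b] ([thin_step]).

Iterating this along the standard integers gives points and radii indexed by
[nat]. Concatenation extends the points to a stable sequence indexed by the
conditional naturals ([extend]); it is conditionally Cauchy because the radii
are halved at each step and the conditional reals are archimedean
([archimedean], from the existence of suprema). Its limit avoids, on all of
[b], every [E_ n] with [n] a constant ([thin_avoids]).

On the other hand, a conditional family is compatible with concatenation in
[n], so the plain union of the sets [E_ n] is already stable and hence
equals [E] ([family_cover]). The limit thus lies in some [E_ n], and [n] agrees
with a constant on a nonzero part of [b]: a contradiction. *)
Set Implicit Arguments.
Unset Strict Implicit.
Unset Printing Implicit Defensive.

Import Order.Theory GRing.Theory Num.Theory.

Local Open Scope classical_set_scope.

(** * Partitions and truth values in a complete Boolean algebra *)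
Section Boole.
Context {d : Order.disp_t} {A : completeBooleType d}.
Implicit Types (a b c : A) (P : A -> Prop).
Local Open Scope order_scope.

Lemma cpartition_meet_neq0 (I : Type) (u : I -> A) b :
  cpartition \top u -> b <> \bot -> exists i, u i `&` b <> \bot.
Proof.
move=> pu b0; apply: contrapT => nex; apply/b0/eqP; rewrite -lex0.
apply: (cpartition_le pu) => i; rewrite lex0; apply/eqP.
by apply: contrapT => ui; apply: nex; exists i.
Qed.

Lemma cpartition_compl a : cpartition \top (fun t : bool => if t then a else ~` a).
Proof.
split=> [[] [] // _|]; rewrite ?meetxC ?meetCx //.
apply/le_anti; rewrite lex1 -(joinxC a) leUx.
by rewrite !csup_ub //; [exists false|exists true].
Qed.

(** A maximal antichain in the dense set of conditions has supremum [b], for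
otherwise density below the remainder would enlarge it. Adding [~` b] turns it
into a partition of [\top]. The conclusion concerns nonzero pieces only, since
[P] is not assumed to hold at [\bot]. *)
Lemma exhaustion P b :
  (forall a c, c <= a -> P a -> P c) ->
  (forall c, c <= b -> c <> \bot -> exists c', [/\ c' <= c, c' <> \bot & P c']) ->
  exists (I : Type) (u : I -> A), cpartition \top u /\
    forall i, u i `&` b <> \bot -> P (u i `&` b).
Proof.
move=> Pdown Pdense.
pose antichain (D : set A) := (forall a, D a -> P a /\ a <= b) /\
  forall a c, D a -> D c -> a <> c -> a `&` c = \bot.
have [|D [[DP Ddisj] Dmax]] := @Zorn_bigcup _ antichain.
  move=> FF FFa FFt; split=> [a [D FD Da]|a c [D FD Da] [D' FD' D'c]].
    exact: (FFa _ FD).1.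
  have [DD'|D'D] := FFt _ _ FD FD'.
    by apply: (FFa _ FD').2 => //; exact: DD'.
  by apply: (FFa _ FD).2 => //; exact: D'D.
have Db : b = csup D.
  apply/le_anti/andP; split; last by apply: csup_le => a /DP[].
  suff /eqP : b `&` ~` csup D = \bot.
    by move=> /eqP b0; rewrite -[b](meetx1) -(joinxC (csup D)) meetUr b0 joinx0 leIr.
  apply: contrapT => b0; have [c [cb c0 Pc]] := Pdense _ (leIl _ _) b0.
  have cD a : D a -> c `&` a = \bot.
    move=> Da; apply/eqP; rewrite -lex0 -(meetCx (csup D)).
    by apply: leI2; [exact: le_trans cb (leIr _ _)|exact: csup_ub].
  have nDc : ~ D c by move=> /cD; rewrite meetxx.
  apply: (Dmax (c |` D)).
    by split=> [a Da|sub]; [right|apply/nDc/sub; left].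
  split=> [a [->|/DP//]|a e [->|Da] [->|De] //].
  - by split=> //; exact: le_trans cb (leIl _ _).
  - by rewrite cD.
  - by rewrite meetC cD.
  - exact: Ddisj.
exists (option {a | D a}), (fun o => if o is Some a then sval a else ~` b).
split; last first.
  move=> [[a /= Da] _|]; last by rewrite meetCx.
  by apply: Pdown (DP _ Da).1; exact: leIl.
split=> [[[a Da]|] [[c Dc]|] //= ne|].
- by apply: Ddisj => // ac; apply: ne; subst c; congr (Some (exist _ _ _)); exact: Prop_irrelevance.
- apply/eqP; rewrite -lex0 -(meetxC b); apply: leI2 => //.
  exact: (DP _ Da).2.
- apply/eqP; rewrite -lex0 -(meetCx b); apply: leI2 => //.
  exact: (DP _ Dc).2.
apply/le_anti; rewrite lex1 /= -(joinxC b) leUx; apply/andP; split.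
  apply: (@le_trans _ _ (csup D)); first by rewrite -Db.
  apply: csup_le => a Da.
  by apply: csup_ub; exists (Some (exist _ a Da)).
by apply: csup_ub; exists None.
Qed.

(** The element [v] is the truth value of [P] in the Boolean-valued sense. *)
Definition local P := exists v, forall a, P a <-> a <= v.

Lemma local_le P a b : local P -> b <= a -> P a -> P b.
Proof. by move=> [v Pv] ba /Pv av; apply/Pv; exact: le_trans av. Qed.

Lemma local_bot P : local P -> P \bot.
Proof. by move=> [v Pv]; apply/Pv; exact: le0x. Qed.

Lemma local_glue P (I : Type) (u : I -> A) c : local P ->
  cpartition \top u -> (forall i, u i `&` c <> \bot -> P (u i `&` c)) -> P c.
Proof.
move=> [v Pv] pu Pu; apply/Pv/(cpartition_le pu) => i.
by have [->|/Pu/Pv//] := pselect (u i `&` c = \bot); exact: le0x.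
Qed.

(** [P] is dense below its supremum, so by exhaustion and gluing it holds there;
the supremum is then its truth value. *)
Lemma localI P :
  (forall a b, b <= a -> P a -> P b) ->
  (forall (I : Type) (u : I -> A) c, cpartition \top u ->
    (forall i, u i `&` c <> \bot -> P (u i `&` c)) -> P c) ->
  local P.
Proof.
move=> Pdown Pglue; exists (csup P) => a; split=> [|aP]; first exact: csup_ub.
apply: (Pdown _ _ aP); have [||I [u [pu uP]]] := @exhaustion P (csup P).
- exact: Pdown.
- move=> c cP c0; apply: contrapT => nex; apply: c0.
  rewrite -(meet_idPr cP); apply: csup_meet_eq0 => e Pe.
  apply: contrapT => ec; apply: nex; exists (e `&` c).
  by split=> //; [exact: leIr|apply: Pdown Pe; exact: leIl].
by apply: (Pglue _ u).
Qed.

Lemma local_forall (T : Type) (P : T -> A -> Prop) :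
  (forall t, local (P t)) -> local (fun a => forall t, P t a).
Proof.
move=> lP; apply: localI => [a b ba Pa t|I u c pu Pu t].
  exact: local_le ba _.
by apply: (local_glue (lP t) pu) => i /Pu.
Qed.

Lemma local_imply (X : Prop) P : local P -> local (fun a => X -> P a).
Proof. by move=> lP; exact: (@local_forall X (fun=> P)). Qed.

Lemma local_meetl P b : local P -> local (fun a => P (b `&` a)).
Proof.
move=> lP; apply: localI => [a c ca|I u c pu Pu].
  by apply: local_le => //; exact: leI2.
apply: (local_glue lP pu) => i; rewrite meetCA => bui0; apply: Pu => ui0.
by apply: bui0; rewrite ui0 meetx0.
Qed.

(** Boolean-valued negation: [b] forces that [P] fails. *)
Definition nowhere P b := forall a, a <= b -> P a -> a = \bot.

(** The truth value of the negation is the complement of that of [P]. *)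
Lemma local_nowhere P : local P -> local (nowhere P).
Proof.
move=> [v Pv]; exists (~` v) => b; split=> [nb|bv a ab /Pv av].
  rewrite -[b]meetx1 -(joinxC v) meetUr (nb (b `&` v)) ?leIl ?join0x ?leIr //.
  by apply/Pv; exact: leIr.
apply/eqP; rewrite -lex0 -(meetxC v) lexI av; exact: le_trans bv.
Qed.

(** Mere failure on [c] becomes forced failure on the nonzero part of [c] that
lies outside the truth value. *)
Lemma localPn P c : local P -> ~ P c ->
  exists c', [/\ c' <= c, c' <> \bot & nowhere P c'].
Proof.
move=> [v Pv] nPc; exists (c `&` ~` v); split; first exact: leIl.
  move=> cv; apply/nPc/Pv.
  by rewrite -[c]meetx1 -(joinxC v) meetUr cv joinx0 leIr.
move=> a acv /Pv av; apply/eqP; rewrite -lex0 -(meetxC v) lexI av.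
exact: le_trans acv (leIr _ _).
Qed.

End Boole.

(** * Localization and mixing in conditional sets *)
Section CondSet.
Context {d : Order.disp_t} {A : completeBooleType d}.
Local Open Scope order_scope.

Section One.
Context {E : condSetType A}.
Implicit Types (x y z : E) (a b c : A) (F : set E).

Section Concat.
Context (I : Type) (u : I -> A) (pu : cpartition \top u).

Definition concat (x_ : I -> E) : E := sval (cid (concat_uniq x_ pu)).

Lemma concatP (x_ : I -> E) : is_concat u x_ (concat x_).
Proof. by rewrite /concat; case: cid => x []. Qed.

Lemma cpartition_eq x y : (forall i, x \at u i = y \at u i) -> x = y.
Proof.
move=> xy; have [z [_ zU]] := concat_uniq (fun=> y) pu.
by rewrite -(zU x) // (zU y).
Qed.

End Concat.

Definition mix a x y : E :=
  concat (cpartition_compl a) (fun t => if t then x else y).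

Lemma mixl a x y : mix a x y \at a = x \at a.
Proof. exact: (concatP (cpartition_compl a) _ true). Qed.

Lemma mixr a x y : mix a x y \at (~` a) = y \at (~` a).
Proof. exact: (concatP (cpartition_compl a) _ false). Qed.

Lemma eq_compl a x y : x \at a = y \at a -> x \at (~` a) = y \at (~` a) -> x = y.
Proof. by move=> xy xy'; apply: (cpartition_eq (cpartition_compl a)) => -[]. Qed.

Lemma restr_bot x y : x \at \bot = y \at \bot.
Proof.
by rewrite -(mixl \bot x y); apply: (restr_le (le0x (~` \bot))); exact: mixr.
Qed.

Lemma restr_top_inj x y : x \at \top = y \at \top -> x = y.
Proof. by move=> xy; apply: (cpartition_eq cpartition_unit) => _. Qed.

(** Gluing equalities on the pieces below [c] uses uniqueness of concatenations
for the partition refined by [c] and its complement, after replacing [x] by an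
element that agrees with [y] off [c]. *)
Lemma local_eq x y : local (fun a => x \at a = y \at a).
Proof.
apply: localI => [a b ba|I u c pu xy]; first exact: restr_le.
rewrite -(mixl c x y); congr (_ \at _).
apply: (cpartition_eq (cpartition_meet pu (cpartition_compl c))) => -[i [|]] /=.
  have [->|ui0] := pselect (u i `&` c = \bot); first exact: restr_bot.
  by rewrite -xy //; apply: (restr_le (leIr _ _)); exact: mixl.
by apply: (restr_le (leIr _ _)); exact: mixr.
Qed.

Lemma stable_mix F a x y z : stable_set F -> F x -> F y ->
  z \at a = x \at a -> z \at (~` a) = y \at (~` a) -> F z.
Proof.
move=> [_ sF] Fx Fy zx zy.
apply: (sF _ _ (fun t : bool => if t then x else y) z (cpartition_compl a)).
  by case.
by case.
Qed.

(** The condition [a] forces [x] to belong to [F]. *)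
Definition holds F x a := exists2 y, F y & y \at a = x \at a.

Lemma holds_in F x a : F x -> holds F x a.
Proof. by exists x. Qed.

Lemma holds_top F x : holds F x \top -> F x.
Proof. by move=> [y Fy /restr_top_inj <-]. Qed.

Lemma holds_ext F x y a : x \at a = y \at a -> holds F x a -> holds F y a.
Proof. by move=> xy [z Fz zx]; exists z; rewrite // zx. Qed.

Lemma local_holds F x : stable_set F -> local (holds F x).
Proof.
move=> sF; have [[x0 Fx0] Fconcat] := sF.
apply: localI => [a b ba [y Fy yx]|I u c pu Fx].
  by exists y => //; exact: restr_le yx.
have /choice[y_ yP] : forall i, exists y, F y /\
    (u i `&` c <> \bot -> y \at (u i `&` c) = x \at (u i `&` c)).
  move=> i; have [ui0|/Fx[y Fy yx]] := pselect (u i `&` c = \bot).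
    by exists x0.
  by exists y.
exists (concat pu y_).
  by apply: (Fconcat _ _ _ _ pu _ (concatP pu y_)) => i; case: (yP i).
apply: (local_glue (local_eq _ _) pu) => i ui0.
by rewrite -(yP i).2 //; apply: (restr_le (leIl _ _)); exact: concatP.
Qed.

(** The maximum principle: concatenate, along a partition given by
[exhaustion], witnesses that work on its pieces. Restricting the witnesses to a
stable set [F] lets extensionality of [Q] rely on global properties such as
positivity of a radius. *)
Lemma mixing F (Q : E -> A -> Prop) b :
  stable_set F -> (forall x, local (Q x)) ->
  (forall x y a, F x -> F y -> x \at a = y \at a -> Q x a -> Q y a) ->
  (forall c, c <= b -> c <> \bot ->
    exists c' x, [/\ c' <= c, c' <> \bot, F x & Q x c']) ->
  exists2 x, F x & Q x b.
Proof.
move=> [[x0 Fx0] Fconcat] lQ extQ denseQ.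
have [||I [u [pu uQ]]] := @exhaustion _ _ (fun c => exists2 x, F x & Q x c) b.
- by move=> a c ca [x Fx Qx]; exists x => //; exact: local_le Qx.
- by move=> c cb /(denseQ _ cb)[c' [x [c'c c'0 Fx Qx]]]; exists c'; split=> //; exists x.
have /choice[x_ xP] : forall i, exists x, F x /\ (u i `&` b <> \bot -> Q x (u i `&` b)).
  move=> i; have [ui0|/uQ[x Fx Qx]] := pselect (u i `&` b = \bot).
    by exists x0.
  by exists x.
have Fx : F (concat pu x_).
  by apply: (Fconcat _ _ _ _ pu _ (concatP pu x_)) => i; case: (xP i).
exists (concat pu x_) => //; apply: (local_glue (lQ _) pu) => i /(xP i).2.
apply: extQ => //; first by case: (xP i).
by apply: (restr_le (leIl _ _)); rewrite concatP.
Qed.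

Lemma stable_set1 x : stable_set [set x].
Proof.
split=> [|I u x_ y pu x_x xy]; first by exists x.
by apply: (cpartition_eq pu) => i; rewrite xy (x_x i).
Qed.

Lemma sub_stable_hull (S : set E) : S `<=` stable_hull S.
Proof. by move=> x Sx F _; exact. Qed.

Lemma stable_stable_hull (S : set E) : S !=set0 -> stable_set (stable_hull S).
Proof.
move=> [x Sx]; split=> [|I u x_ y pu Sx_ xy F sF SF].
  by exists x; exact: sub_stable_hull.
by apply: (sF.2 _ _ x_ y pu) => // i; exact: Sx_.
Qed.

End One.

(** Stable functions are local: [x] is a concatenation of [y] on [a] and of
itself on the complement. *)
Lemma stable_fun_restr (E F : condSetType A) (f : E -> F) x y (a : A) :
  stable_fun f -> x \at a = y \at a -> f x \at a = f y \at a.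
Proof.
move=> sf xy.
apply: (sf _ _ (fun t : bool => if t then y else x) x (cpartition_compl a) _ true).
by case.
Qed.

Lemma stable_preimage (E F : condSetType A) (f : E -> F) (S : set F) :
  stable_fun f -> stable_set S -> f @^-1` S !=set0 -> stable_set (f @^-1` S).
Proof.
move=> sf [_ sS] ne; split=> // I u x_ x pu Sx_ xx_.
exact: (sS _ _ _ _ pu Sx_ (sf _ _ _ _ pu xx_)).
Qed.

Section Extend.
Context {V : pointedType} {E : condSetType A} (f : V -> E).

(** A function on the standard elements, such as a sequence indexed by the
positive integers, has a unique stable extension to formal sums. *)
Definition extend (n : formal_sum A V) : E := concat (fs_part n) f.

Lemma extendE (n : formal_sum A V) v a : a <= n v -> extend n \at a = f v \at a.
Proof. by move=> /restr_le; apply; exact: concatP. Qed.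

Lemma stable_extend : stable_fun extend.
Proof.
move=> I u n_ n pu nn_ i; apply: (local_glue (local_eq _ _) (fs_part n)) => v _.
rewrite (@extendE _ v) ?leIl //; rewrite (@extendE _ v) //.
by have [/funeqP/(_ v) ->] := nn_ i; exact: leIl.
Qed.

End Extend.

Lemma fs_const_at (V : Type) (v : V) : fs_const (A := A) v v = \top.
Proof. by apply/le_anti; rewrite lex1; apply: csup_ub; exists tt. Qed.

Lemma fs_const_neq (V : Type) (v w : V) : v <> w -> fs_const (A := A) v w = \bot.
Proof.
by move=> vw; rewrite -[LHS]meet1x; exact: (fsum_at_meet cpartition_unit (i := tt) vw).
Qed.

Lemma fs_const_restr (V : pointedType) (n : formal_sum A V) v a :
  a <= n v -> n \at a = fs_const v \at a.
Proof.
move=> /meet_idPr av; congr pair; apply: funext => w.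
have [->|wv] := pselect (w = v); first by rewrite fs_const_at meet1x.
by rewrite (fs_const_neq (nesym wv)) meet0x -av meetA ((fs_part n).1 _ _ wv) meet0x.
Qed.

Lemma fop_const (V W X : Type) (op : V -> W -> X) v w :
  fop op (fs_const v) (fs_const w) = fs_const (op v w) :> formal_sum A X.
Proof.
have ovw : fop op (fs_const (A := A) v) (fs_const w) (op v w) = \top.
  apply/le_anti; rewrite lex1; apply: csup_ub; exists (v, w) => //.
  by rewrite !fs_const_at meetxx.
apply: formal_sumP => z; have [<-|zvw] := pselect (op v w = z).
  by rewrite ovw fs_const_at.
rewrite fs_const_neq // -[LHS]meet1x -ovw.
exact: (fs_part (fop op (fs_const v) (fs_const w))).1.
Qed.

End CondSet.

(** * Order and suprema in the conditional reals *)
Section Real.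
Context {d : Order.disp_t} {A : completeBooleType d} {R : condRealType A}.
Implicit Types (r s t : R) (a b c : A).
Local Open Scope ring_scope.

Lemma cle_leD r s t u : r <=c s -> t <=c u -> r + t <=c s + u.
Proof.
move=> rs tu; apply: cle_trans (cle_add _ _ t rs) _.
by rewrite ![s + _]addrC; exact: cle_add.
Qed.

Lemma cle_addl r s : 0 <=c r -> s <=c r + s.
Proof. by move=> r0; have := cle_add _ _ s r0; rewrite add0r. Qed.

(** If the image of [q] vanished on [a <> \bot], then the formal sum equal to
[q] on [a] and to [0] elsewhere would have image [0], against the fact that
[crat] reflects the order. *)
Lemma crat_const_gt0 (q : rat) : 0 < q -> clt 0 (crat (fs_const q) : R).
Proof.
move=> q0.
have crat0 : crat (fs_const (0 : rat)) = 0 :> R.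
  have := crat_addE (fs_const (0 : rat)) (fs_const (0 : rat)) : _ = _ :> R.
  rewrite /crat_add fop_const addr0 => c0.
  by rewrite -[RHS](subrr (crat (fs_const (0 : rat)))) {2}c0 addrK.
split.
  rewrite -crat0; apply/crat_leE/frelE => _ _ _; exact: ltW.
move=> a a0 qa.
pose m : condRat A := @mix _ _ (condRat A) a (fs_const q) (fs_const 0).
have m0 : crat m = crat (fs_const (0 : rat)) :> R.
  apply: (@eq_compl _ _ _ a).
    rewrite crat0 qa; apply: stable_fun_restr; first exact: stable_crat.
    exact: mixl.
  by apply: stable_fun_restr; [exact: stable_crat|exact: mixr].
have : crat_le m (fs_const (0 : rat)) by apply/(@crat_leE _ _ R); rewrite m0; exact: cle_refl.
move=> /(_ q 0); rewrite leNgt q0; move=> /(_ _)/negP; apply => // mq; apply: a0.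
have [/funeqP/(_ q) mE] := @mixl _ _ (condRat A) a (fs_const q) (fs_const 0).
have {mE}: (m q `&` a)%O = (fs_const q q `&` a)%O by [].
rewrite fs_const_at meet1x => <-.
by move: mq; rewrite fs_const_at meetx1 => ->; rewrite meet0x.
Qed.

(** This identifies the positive cone [Rpplus] with [clt 0]: taking the hull
adds nothing, since any nonzero condition meets a piece of the partition. *)
Lemma stable_clt0 : stable_set [set r : R | clt 0 r].
Proof.
split=> [|I u r_ r pu r_gt0 rr_]; first by exists (crat (fs_const 1)); exact: crat_const_gt0.
split.
  apply: (stable_cle.2 _ _ (fun i => (0, r_ i)) (0, r) pu) => [i|i]; first exact: (r_gt0 i).1.
  by congr pair; exact: rr_.
move=> a a0 ra; have [i ui0] := cpartition_meet_neq0 pu a0.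
apply: (r_gt0 i).2 ui0 _; rewrite (restr_le (leIr _ _) ra).
by apply: (restr_le (leIl _ _)); exact: rr_.
Qed.

Lemma Rpplus_clt r : Rpplus r -> clt 0 r.
Proof. by apply; [exact: stable_clt0|]. Qed.

Lemma restrM r s r' s' a :
  r \at a = r' \at a -> s \at a = s' \at a -> (r * s) \at a = (r' * s') \at a.
Proof.
move=> rr' ss'; apply: (@stable_fun_restr _ _ _ _ _ (r, s) (r', s') _ stable_mul).
by congr pair.
Qed.

Lemma restrD r s r' s' a :
  r \at a = r' \at a -> s \at a = s' \at a -> (r + s) \at a = (r' + s') \at a.
Proof.
move=> rr' ss'; apply: (@stable_fun_restr _ _ _ _ _ (r, s) (r', s') _ stable_add).
by congr pair.
Qed.

Lemma clt0_half r : clt 0 r -> exists s, clt 0 s /\ s + s = r.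
Proof.
move=> [r0 rN0]; pose h : R := crat (fs_const (2%:R^-1 : rat)).
have [h0 _] : clt 0 h by exact: crat_const_gt0.
have hh : h + h = 1.
  by rewrite -crat_oneE -crat_addE /crat_add fop_const.
have hr : h * r + h * r = r by rewrite -mulrDl hh mul1r.
exists (h * r); split=> //; split; first exact: cle_mul.
move=> a a0 hra; apply: (rN0 a a0).
by rewrite -[0]addr0 -hr; exact: restrD.
Qed.

(** The minimum is [r] where [r] is the smaller one, and [s] on the complement. *)
Lemma clt0_min r s : clt 0 r -> clt 0 s ->
  exists t, [/\ clt 0 t, t <=c r & t <=c s].
Proof.
move=> r0 s0; have [a [[t [tr ts les]] [t' [t's t'r ler]]]] := cle_total r s.
rewrite complK in t'r.
have tt' : t = t' by apply: (@eq_compl _ _ _ a); [rewrite tr|rewrite ts].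
exists t; split=> //; last by rewrite tt'.
exact: (stable_mix stable_clt0 r0 s0 tr ts).
Qed.

Definition le_on r s a := holds [set p : R * R | p.1 <=c p.2] (r, s) a.

Lemma local_le_on r s : local (le_on r s).
Proof. exact/local_holds/stable_cle. Qed.

Lemma cle_on r s a : r <=c s -> le_on r s a.
Proof. by move=> rs; exists (r, s). Qed.

Lemma le_on_top r s : le_on r s \top%O -> r <=c s.
Proof. exact: holds_top. Qed.

Lemma le_on_ext r s r' s' a :
  r \at a = r' \at a -> s \at a = s' \at a -> le_on r s a -> le_on r' s' a.
Proof. by move=> rr' ss'; apply: holds_ext; congr pair. Qed.

(** Multiplication by this indicator turns inequalities on [a] into global
ones, so that the order axioms and ring laws apply to them. *)
Definition ind a : R := mix a 1 0.

Lemma ind_mull a r : (ind a * r) \at a = r \at a.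
Proof. by rewrite -[in RHS](mul1r r); apply: restrM => //; exact: mixl. Qed.

Lemma ind_mulr a r : (ind a * r) \at (~` a)%O = 0 \at (~` a)%O.
Proof. by rewrite -[0](mul0r r); apply: restrM => //; exact: mixr. Qed.

Lemma le_onE r s a : le_on r s a <-> ind a * r <=c ind a * s.
Proof.
split=> [[[r' s'] /= rs' [rr ss]]|rs]; last first.
  by exists (ind a * r, ind a * s) => //; congr pair; exact: ind_mull.
apply: (@stable_mix _ _ _ _ a (r', s') (0, 0) (ind a * r, ind a * s) stable_cle) => //=.
- exact: cle_refl.
- by congr pair; rewrite ind_mull.
- by congr pair; exact: ind_mulr.
Qed.

Lemma le_on_trans r s t a : le_on r s a -> le_on s t a -> le_on r t a.
Proof. by move=> /le_onE rs /le_onE st; apply/le_onE; exact: cle_trans st. Qed.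

Lemma le_onD r s t u a : le_on r s a -> le_on t u a -> le_on (r + t) (s + u) a.
Proof.
by move=> /le_onE rs /le_onE tu; apply/le_onE; rewrite !mulrDr; exact: cle_leD.
Qed.

Lemma stable_le_cst s : stable_set [set r | r <=c s].
Proof.
split=> [|I u r_ r pu r_s rr_]; first by exists s; exact: cle_refl.
apply: (stable_cle.2 _ _ (fun i => (r_ i, s)) (r, s) pu) => // i.
by congr pair; exact: rr_.
Qed.

(** Upper bounds of a set and of its stable hull coincide, since the elements
below a given one form a stable set. *)
Lemma csupremum_nonempty (S : set R) : S !=set0 ->
  (exists u, forall r, S r -> r <=c u) ->
  exists s, (forall r, S r -> r <=c s) /\
    forall u, (forall r, S r -> r <=c u) -> s <=c u.
Proof.
move=> S0 [u Su]; have hullP v : (forall r, S r -> r <=c v) <->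
    forall r, stable_hull S r -> r <=c v.
  split=> [Sv r /(_ _ (stable_le_cst v) Sv)//|Sv r Sr].
  by apply: Sv; exact: sub_stable_hull.
have [|s [ubs leasts]] := csupremum _ (stable_stable_hull S0).
  by exists u; exact: (hullP u).1.
exists s; split; first exact: (hullP s).2.
by move=> v Sv; apply/leasts/(hullP v).1.
Qed.

(** The usual supremum argument, localized to [a]: if [t] is the supremum of
the multiples of [r] cut off outside [a], then lowering [t] by [r] on [a] gives
another upper bound, so [r] vanishes on [a]. *)
Lemma bounded_multiples r s a : clt 0 r ->
  (forall k, le_on (r *+ k) s a) -> a = \bot%O.
Proof.
move=> [r0 rN0] rs; apply: contrapT => a0.
have [||t [tub tleast]] := @csupremum_nonempty [set ind a * r *+ k | k in [set: nat]].
- by exists (ind a * r *+ 0); exists 0%N.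
- exists (ind a * s) => _ [k _ <-].
  by rewrite -mulrnAr; apply/le_onE.
have tr : t <=c t - ind a * r.
  apply: tleast => _ [k _ <-]; rewrite -[X in X <=c _](addrK (ind a * r)) -mulrSr.
  by apply: cle_add; apply: tub; exists k.+1.
have ir0 : ind a * r <=c 0.
  have := cle_add _ _ (ind a * r - t) tr.
  by rewrite addrCA subrr addr0 addrA subrK subrr.
have ir : ind a * r = 0.
  apply: cle_anti ir0 _; have /le_onE : le_on 0 r a by exact: cle_on.
  by rewrite mulr0.
by apply: (rN0 a a0); rewrite -(ind_mull a r) ir.
Qed.

(** If no [e_ k] were below [r] on some nonzero part of a condition [c], totality
would put [r] below all of them on [c], and by halving all multiples of [r]
below [e_ 1]. Hence, below every nonzero condition, some constant index works on
a smaller one, and mixing assembles the conditional index [n]. *)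
Lemma archimedean (e_ : nat -> R) r : clt 0 r ->
  (forall k, e_ k.+1 + e_ k.+1 <=c e_ k) ->
  exists n : condNat A, forall k, le_on (e_ (val k)) r (n k).
Proof.
move=> r0 e_half.
pose Q (n : condNat A) c := forall k, le_on (e_ (val k)) r (n k `&` c)%O.
have [||||n _ Qn] := @mixing _ _ (condNat A) setT Q \top%O.
- split=> //; have [n] := @cinhabited _ _ (condNat A); by exists n.
- by move=> n; apply: local_forall => k; apply/local_meetl/local_le_on.
- by move=> n m a _ _ [/funeqP nm] Qn k; rewrite -nm.
- move=> c _ c0; apply: contrapT => nex; apply: c0.
  have rle k : le_on r (e_ k.+1) c.
    have [a [le_r ge_r]] := cle_total r (e_ k.+1).
    have {le_r} le_r : le_on r (e_ k.+1) a.
      by have [t [tr _ te]] := le_r; exists (t, e_ k.+1); rewrite //=; congr pair.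
    have {ge_r} ge_r : le_on (e_ k.+1) r (~` a)%O.
      by have [t [te _ tr]] := ge_r; exists (t, r); rewrite //=; congr pair.
    apply: (local_le (local_le_on _ _) _ le_r); rewrite -[c]meetx1 -(joinxC a).
    rewrite meetUr; suff -> : (c `&` ~` a)%O = \bot%O by rewrite joinx0 leIr.
    apply: contrapT => ca0; pose k' : posnat := exist _ k.+1 (ltn0Sn k).
    apply: nex; exists (c `&` ~` a)%O, (fs_const k'); split=> //; first exact: leIl.
    move=> j; have [<-|kj] := pselect (k' = j).
      by apply: (local_le (local_le_on _ _) _ ge_r); rewrite meetA leIr.
    by rewrite (fs_const_neq kj) meet0x; exact: local_bot (local_le_on _ _).
  apply: (@bounded_multiples r (e_ 1%N) _ r0) => j; elim: j 0%N => [|j IH] k.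
    exact: le_on_trans (cle_on _ r0.1) (rle k).
  apply: le_on_trans (cle_on _ (e_half k.+1)); rewrite mulrS.
  exact: le_onD.
by exists n => k; rewrite -[n k]meetx1; exact: Qn.
Qed.

End Real.

(** * Conditional subsets and families *)
Section Csubset.
Context {d : Order.disp_t} {A : completeBooleType d} {E : condSetType A}.
Implicit Types (x y : E) (a b c : A) (F : set E).
Local Open Scope order_scope.

Lemma csubset_restr F x a c : a <= c -> csubset F c (x \at a) <-> holds F x a.
Proof.
move=> ac; split=> [[y [b [Fy bc xy]]]|[y Fy yx]]; last by exists y, a.
by exists y => //; rewrite xy (restr_inj xy).
Qed.

Lemma csubset_hullS S F a : stable_set F -> S `<=` F ->
  csubset (stable_hull S) a `<=` csubset F a.
Proof. by move=> sF SF _ [x [b [Sx ba ->]]]; exists x, b; split=> //; exact: Sx. Qed.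

Context {F_ : condNat A -> set E} (F_family : cfamily F_).

Lemma family_ext n n' x a :
  n \at a = n' \at a -> holds (F_ n) x a -> holds (F_ n') x a.
Proof.
move=> nn' /(csubset_restr _ _ (lexx a)) Fx; apply/(csubset_restr _ _ (lexx a)).
rewrite (F_family.2 _ _ (fun t : bool => if t then n else n') n' (cpartition_compl a) _ true) //.
by case.
Qed.

(** The union of the [F_ n] is stable: a concatenation of points of the
[F_ (n_ i)] lies in [F_ n] for [n] the concatenation of the [n_ i]. Being a
conditional subset that contains the family, it is everything. *)
Lemma family_cover :
  is_cunion (range (fun n => csubset (F_ n) \top)) (cfull E) ->
  forall x, exists n, F_ n x.
Proof.
move=> [_ _ least] x; pose U := [set y | exists n, F_ n y].
apply: (@holds_top _ _ _ U); apply/(csubset_restr _ _ (lexx \top)).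
apply: least; last by exists x, \top.
  exists \top, U => //; split=> [|I u x_ y pu /choice[n_ Fn_] xy].
    have [n] := @cinhabited _ _ (condNat A).
    by have [[y Fy] _] := F_family.1 n; exists y, n.
  exists (concat pu n_); apply: holds_top.
  apply: (local_glue (local_holds _ (F_family.1 _)) pu) => i _.
  rewrite meetx1; apply: (@family_ext (n_ i)); first by rewrite concatP.
  by exists (x_ i); [exact: Fn_|rewrite xy].
by move=> _ [n _ <-] _ [y [a [Fy aT ->]]]; exists y, a; split=> //; exists n.
Qed.

End Csubset.

(** * Conditional metric spaces and the Baire argument *)
Section Metric.
Context {d : Order.disp_t} {A : completeBooleType d} {R : condRealType A}.
Context {E : condSetType A} {dist : E * E -> R} (dist_metric : cmetric dist).
Implicit Types (r s t : R) (a b c : A) (x y z : E).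
Local Open Scope ring_scope.

Lemma dist_stable : stable_fun dist. Proof. by case: dist_metric. Qed.

Lemma distC x y : dist (x, y) = dist (y, x). Proof. by case: dist_metric. Qed.

Lemma distxx x : dist (x, x) = 0.
Proof. by case: dist_metric => _ _ _ _ dist0; exact/dist0. Qed.

Lemma dist_triangle x y z : dist (x, z) <=c dist (x, y) + dist (y, z).
Proof. by case: dist_metric. Qed.

Lemma dist_restr x y x' y' a : x \at a = x' \at a -> y \at a = y' \at a ->
  dist (x, y) \at a = dist (x', y') \at a.
Proof. by move=> xx yy; apply: stable_fun_restr dist_stable _; congr pair. Qed.

(** Off [a] the mixed point is the centre itself, at distance [0] from it;
[0 <=c r] is what makes this harmless. *)
Lemma ball_mix x x' y r r' a : x' \at a = x \at a -> r' \at a = r \at a ->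
  0 <=c r -> dist (x', y) <=c r' -> dist (x, mix a y x) <=c r.
Proof.
move=> xx rr r0 yr; apply: le_on_top.
apply: (local_glue (local_le_on _ _) (cpartition_compl a)) => -[] _; rewrite meetx1.
  apply: le_on_ext (cle_on a yr) => //.
  by apply: dist_restr => //; rewrite mixl.
apply: le_on_ext (cle_on _ r0) => //.
by rewrite -(distxx x); apply: dist_restr => //; rewrite mixr.
Qed.

Lemma stable_ball x r : 0 <=c r -> stable_set [set y | dist (x, y) <=c r].
Proof.
move=> r0; apply: (@stable_preimage _ _ _ _ (fun y => dist (x, y)) [set s | s <=c r]).
- move=> I u y_ y pu yy_.
  by apply: (dist_stable (x_ := fun i => (x, y_ i)) pu) => i; congr pair; exact: yy_.
- exact: stable_le_cst.
- by exists x; rewrite /= distxx.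
Qed.

(** Forced non-membership on [b] says that the conditional subset generated by
[y] on [b] is disjoint from [F], so it lies in the open complement. That
complement lives on some [g >= b]: a point [h] of it that agrees with [y] on [b]
provides the radius, and points near [y] are moved near [h] by changing them
off [b]. *)
Lemma closed_separation F y b : stable_set F -> cclosed dist (csubset F \top%O) ->
  nowhere (holds F y) b ->
  exists s, clt 0 s /\ forall z, dist (y, z) <=c s -> nowhere (holds F z) b.
Proof.
move=> sF [_ [G [_ FG0 Gmax] [g [H sH GE] Gopen]]] Fy.
have : G (y \at b).
  apply: (Gmax (csubset [set y] b)); last by exists y, b.
    by exists b, [set y] => //; exact: stable_set1.
  apply/seteqP; split=> [o [Fo [_ [a [-> ab oy]]]]|_ [x [a [_ a0 ->]]]].
    (* An object in both sets is forced to have condition [\bot]. *)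
    rewrite oy in Fo *; move/(csubset_restr _ _ (lex1 a)) in Fo.
    by exists y, a; rewrite (Fy a).
  move: a0; rewrite lex0 => /eqP ->; have [[x0 Fx0] _] := sF; split.
    by exists x0, \bot%O; split; rewrite ?lex1 //; exact: restr_bot.
  by exists y, \bot%O; split; rewrite ?le0x //; exact: restr_bot.
rewrite GE => -[h [b' [Hh b'g yh]]]; have bb' := restr_inj yh; subst b'.
have [|s /Rpplus_clt s0 ball_sub] := Gopen h; first by rewrite GE; exists h, g.
exists s; split=> // z yz a ab [w Fw wz].
have Gz : G (mix b z h \at a).
  apply: ball_sub; exists (mix b z h), a; split=> //; last exact: le_trans ab b'g.
  by apply: sub_stable_hull; exact: (ball_mix yh erefl s0.1 yz).
have Fz : csubset F \top%O (mix b z h \at a).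
  by apply/(csubset_restr _ _ (lex1 a)); exists w; rewrite // wz (restr_le ab (mixl _ _ _)).
have : (csubset F \top%O `&` G) (mix b z h \at a) by [].
by rewrite FG0 => -[x [c [_ + /restr_inj ->]]]; rewrite lex0 => /eqP.
Qed.

(** The sum of distance and next radius in the hypothesis makes the balls of
radius [r_ k] nested. The bound on the limit is [r_ k + r_ k] exactly, without
an additional arbitrarily small error, because a term of the sequence within
[r_ k] of the limit can be chosen beyond index [k]. *)
Lemma nested_balls_limit (x_ : nat -> E) (r_ : nat -> R) : ccomplete dist ->
  (forall k, clt 0 (r_ k)) ->
  (forall k, r_ k.+1 + r_ k.+1 <=c r_ k) ->
  (forall k, dist (x_ k, x_ k.+1) + r_ k.+1 <=c r_ k) ->
  exists x, forall k, dist (x_ k, x) <=c r_ k + r_ k.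
Proof.
move=> dist_complete r0 r_half x_next.
have x_ball i j : (i <= j)%N -> dist (x_ i, x_ j) <=c r_ i.
  move=> ij; apply: (@cle_trans _ _ R _ (dist (x_ i, x_ j) + r_ j)).
    by rewrite addrC; apply: cle_addl; exact: (r0 j).1.
  rewrite -(subnKC ij); elim: (j - i)%N => [|k IH].
    by rewrite addn0 distxx add0r; exact: cle_refl.
  apply: cle_trans IH; rewrite addnS.
  apply: cle_trans (cle_leD (cle_refl (dist (x_ i, x_ (i + k)%N))) (x_next _)).
  by rewrite addrA; apply: cle_add; exact: dist_triangle.
pose s_ := extend (fun k : posnat => x_ (val k)).
have [||x x_lim] := dist_complete s_; first exact: stable_extend.
  move=> r /Rpplus_clt r_gt0.
  have [k|n nP] := @archimedean _ _ R (fun k => r_ k + r_ k) r r_gt0.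
    exact: cle_leD.
  exists n => p q np nq; apply: le_on_top.
  apply: (local_glue (local_le_on _ _) (fs_part n)) => m _.
  apply: (local_glue (local_le_on _ _) (fs_part p)) => i _.
  apply: (local_glue (local_le_on _ _) (fs_part q)) => j.
  rewrite meetx1; set c := (_ `&` _)%O => c0.
  have cn : (c <= n m)%O by rewrite /c meetA leIr.
  have cp : (c <= p i)%O by rewrite /c meetCA leIl.
  have cq : (c <= q j)%O by rewrite /c leIl.
  have mi : (val m < val i)%N.
    apply: np => np0; apply: c0; apply/eqP; rewrite -lex0 -np0.
    by rewrite lexI cn cp.
  have mj : (val m < val j)%N.
    apply: nq => nq0; apply: c0; apply/eqP; rewrite -lex0 -nq0.
    by rewrite lexI cn cq.
  apply: le_on_trans (local_le (local_le_on _ _) cn (nP m)).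
  apply: (@le_on_ext _ _ _ (dist (x_ (val i), x_ (val j)))) => //.
    by apply: dist_restr; rewrite (extendE _ cp, extendE _ cq).
  apply: cle_on; apply: cle_trans (dist_triangle _ (x_ (val m)) _) _.
  by apply: cle_leD; rewrite ?[dist (x_ (val i), _)]distC; apply: x_ball; exact: ltnW.
exists x => k; have r_next : Rpplus (r_ k) by apply: sub_stable_hull; exact: r0.
have [N NP] := x_lim _ r_next.
(* The index is the maximum of [N] and [k], computed piece by piece: a
   conditional index beyond [N] where the sequence is within [r_ k] of
   [x_ k]. *)
pose maxp (j : posnat) : posnat := exist _ (maxn (val j) k) (leq_trans (valP j) (leq_maxl _ _)).
pose n : condNat A := fsum maxp (fs_part N).
have Nn : cnat_le N n.
  move=> v w Nvw; have [<-|mv] := pselect (maxp v = w); first exact: leq_maxl.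
  by case: Nvw; exact: (fsum_at_meet (fs_part N) mv).
apply: cle_trans (dist_triangle _ (s_ n) _) _; apply: cle_leD (NP _ Nn).
apply: le_on_top; apply: (local_glue (local_le_on _ _) (fs_part N)) => j _.
rewrite meetx1; apply: le_on_ext (cle_on _ (x_ball k (maxn (val j) k) (leq_maxr _ _))) => //.
apply: dist_restr => //; rewrite (@extendE _ _ _ _ _ _ (maxp j)) //.
by apply: csup_ub; exists j.
Qed.

Section Baire.
Context {E_ : condNat A -> set E} (E_family : cfamily E_).

(** On no nonzero part of [b] is a ball contained in a set of the family. *)
Definition thin b := forall c, (c <= b)%O -> c <> \bot%O ->
  forall x r n, clt 0 r -> exists y, dist (x, y) <=c r /\ ~ holds (E_ n) y c.

(** If no condition [b] is thin, then below every nonzero condition there is a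
ball contained in a set of the family on a smaller one, and mixing applies to
the triples of centre, radius and index. *)
Lemma ball_or_thin :
  (exists x r n, clt 0 r /\ forall y, dist (x, y) <=c r -> E_ n y) \/
  exists2 b, b <> \bot%O & thin b.
Proof.
have [|nex] := pselect (exists2 b, b <> \bot%O & thin b); [by right|left].
pose Q (p : E * R * condNat A) c :=
  forall y, dist (p.1.1, y) <=c p.1.2 -> holds (E_ p.2) y c.
have [||||[[x r] n] /= r0 xrn] := @mixing _ _ (E * R * condNat A)%type
    [set p | clt 0 p.1.2] Q \top%O.
- apply: (@stable_preimage _ _ _ _ (fun p : E * R * condNat A => p.1.2) [set r | clt 0 r]).
  + by move=> I u p_ p pu pp i; case: (pp i).
  + exact: stable_clt0.
  + have [x] := @cinhabited _ _ E; have [n] := @cinhabited _ _ (condNat A).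
    by have [[r r0] _] := @stable_clt0 _ _ R; exists (x, r, n).
- move=> p; apply: local_forall => y; apply: local_imply.
  exact/local_holds/E_family.1.
- move=> [[x r] n] [[x' r'] n'] a /= r0 r'0 [xx rr nn] Qp y x'y.
  apply: (@family_ext _ _ _ _ E_family n); first by congr pair.
  apply: holds_ext (Qp _ (@ball_mix x x' y r r' a _ _ r0.1 x'y)) => //.
  exact: mixl.
- move=> c _ c0; apply: contrapT => nc; apply: nex; exists c => // c' c'c c'0 x r n r0.
  apply: contrapT => ny; apply: nc; exists c', (x, r, n); split=> // y xy.
  by apply: contrapT => Ey; apply: ny; exists y.
exists x, r, n; split=> // y xy; apply: holds_top; exact: xrn.
Qed.

(** Density gives [y] in the ball of half the radius that avoids [E_ n] on all
of [b]: each failure of containment supplies a point avoiding [E_ n] on a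
smaller condition, and these points are mixed inside the stable ball. The
avoiding ball has radius [s + s] because [nested_balls_limit] locates the limit
up to twice the radius. *)
Lemma thin_step b x r n : cclosed dist (csubset (E_ n) \top%O) -> thin b -> clt 0 r ->
  exists y s, [/\ clt 0 s, s + s <=c r, dist (x, y) + s <=c r &
    forall z, dist (y, z) <=c s + s -> nowhere (holds (E_ n) z) b].
Proof.
move=> E_closed thinb r0; have [h [h0 hhr]] := clt0_half r0.
have sE := E_family.1 n.
have [||||y xy Ey] := @mixing _ _ E [set y | dist (x, y) <=c h]
    (fun y => nowhere (holds (E_ n) y)) b.
- exact: stable_ball h0.1.
- by move=> y; exact/local_nowhere/local_holds.
- move=> y z a _ _ yz Ey c ca Ez; apply: Ey => //; apply: holds_ext Ez.
  by apply: (restr_le ca); rewrite yz.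
- move=> c cb c0; have [y [xy nEy]] := thinb c cb c0 x h n h0.
  have [c' [c'c c'0 Ey]] := localPn (local_holds _ sE) nEy.
  by exists c', y.
have [s [s0 Es]] := closed_separation sE E_closed Ey.
have [t [t0 ts th]] := clt0_min s0 h0; have [e [e0 eet]] := clt0_half t0.
have et : e <=c t by rewrite -eet; exact: cle_addl e0.1.
exists y, e; rewrite eet; split=> //.
- apply: cle_trans th _; rewrite -hhr; exact: cle_addl h0.1.
- rewrite -hhr; apply: cle_leD xy _; exact: cle_trans et th.
- by move=> z yz; apply: Es; exact: cle_trans yz ts.
Qed.

Lemma thin_avoids b : ccomplete dist ->
  (forall n, cclosed dist (csubset (E_ n) \top%O)) -> thin b ->
  exists x, forall k : posnat, nowhere (holds (E_ (fs_const k)) x) b.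
Proof.
move=> dist_complete E_closed thinb.
have /choice[f fP] : forall p : posnat * (E * R), exists q : E * R, clt 0 p.2.2 ->
    [/\ clt 0 q.2, q.2 + q.2 <=c p.2.2, dist (p.2.1, q.1) + q.2 <=c p.2.2 &
    forall z, dist (q.1, z) <=c q.2 + q.2 -> nowhere (holds (E_ (fs_const p.1)) z) b].
  move=> [k [x r]] /=; have [r0|nr0] := pselect (clt 0 r); last by exists (x, r).
  by have [y [s ?]] := thin_step x (E_closed (fs_const k)) thinb r0; exists (y, s).
have [x0] := @cinhabited _ _ E; have [[r0 r0_gt0] _] := @stable_clt0 _ _ R.
pose fix X k : E * R :=
  if k is j.+1 then f (exist _ j.+1 (ltn0Sn j), X j) else (x0, r0).
have Xpos k : clt 0 (X k).2.
  elim: k => //= k IH; by case: (fP (exist _ k.+1 (ltn0Sn k), X k) IH).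
have XP k := fP (exist _ k.+1 (ltn0Sn k), X k) (Xpos k).
have [|||x xP] := @nested_balls_limit (fun k => (X k).1) (fun k => (X k).2) dist_complete.
- exact: Xpos.
- by move=> k; case: (XP k).
- by move=> k; case: (XP k).
exists x => -[[//|k] k0]; have [_ _ _] := XP k; move=> /(_ x (xP k.+1)).
by rewrite (_ : k0 = ltn0Sn k) //; exact: bool_irrelevance.
Qed.

End Baire.
End Metric.

Theorem theorem2p1 (d : Order.disp_t) (A : completeBooleType d)
    (R : condRealType A) (E : condSetType A) (dist : E * E -> R)
    (E_ : condNat A -> set E)
    (dist_metric : cmetric dist)
    (dist_complete : ccomplete dist)
    (E_family : cfamily E_)
    (E_closed : forall n, cclosed dist (csubset (E_ n) \top%O))
    (E_cover : is_cunion (range (fun n => csubset (E_ n) \top%O)) (cfull E)) :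
  exists (x : E) (r : R) (n : condNat A),
    Rpplus r /\ csubset (cball dist x r) \top%O `<=` csubset (E_ n) \top%O.
Proof.
have [[x [r [n [r0 xrE]]]]|[b b0 thinb]] := ball_or_thin dist_metric E_family.
  exists x, r, n; split; first exact: sub_stable_hull.
  by apply: csubset_hullS; first exact: E_family.1.
have [x xP] := thin_avoids dist_metric E_family dist_complete E_closed thinb.
have [n Enx] := family_cover E_family E_cover x.
have [k nk0] := cpartition_meet_neq0 (fs_part n) b0.
case: nk0; apply: (xP k); first exact: leIr.
apply: (family_ext E_family (n := n)); last exact: holds_in.
by apply: fs_const_restr; exact: leIl.
Qed.
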